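(* Consider the two-user state-dependent discrete memoryless broadcast channel $\mathrm{C}_2$ (Class II) with finite alphabets $\mathcal{W},\mathcal{X},\mathcal{Y}_1,\mathcal{Y}_2$, state distribution $p(w)$, transition law $p(y_1,y_2|x,w)$, the state sequence known noncausally at the encoder, and each receiver knowing a priori the message it need not decode. Let $\mathcal{C}_2$ be its capacity region. Let $\mathcal{P}_2$ be the set of all joint distributions $p_2$ of $(W,U,X,Y_1,Y_2)$, with an auxiliary random variable $U\in\mathcal{U}$ on a finite set, of the form $$p(w)\,p(u|w)\,p(x|w,u)\,p(y_1,y_2|x,w)$$ (so that $U\to(X,W)\to(Y_1,Y_2)$ is a Markov chain). For $p_2\in\mathcal{P}_2$ let $\mathcal{R}_{2,\mathrm{in}}(p_2)$ be the convex hull of the set of all rate pairs $(R_1,R_2)$, $R_1,R_2\ge0$, satisfying simultaneously $$R_1\le I(U;Y_1)-I(U;W),\qquad R_2\le I(U;Y_2)-I(U;W).$$ Let $\mathcal{R}_{2,\mathrm{in}}=\bigcup_{p_2\in\mathcal{P}_2}\mathcal{R}_{2,\mathrm{in}}(p_2)$. Then $\mathcal{R}_{2,\mathrm{in}}\subseteq\mathcal{C}_2$.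
   Context: Channel model. A sender communicates over $\mathrm{N}$ channel uses with two receivers $\mathrm{D}_1,\mathrm{D}_2$. The state sequence $\mathbf{W}=(W_1,\dots,W_{\mathrm{N}})$ is i.i.d. $\sim p(w)$ and independent of the messages; the channel is memoryless: $p(\mathbf{y}_1,\mathbf{y}_2|\mathbf{x},\mathbf{w})=\prod_{n=1}^{\mathrm{N}}p(y_{1,n},y_{2,n}|x_n,w_n)$. The messages $M_t$, $t=1,2$, are independent and uniform on $\mathcal{M}_t=\{1,\dots,2^{\mathrm{N}R_t}\}$ ($2^{\mathrm{N}R_t}$ is treated as an integer without loss of generality). Receiver $\mathrm{D}_1$ must decode $M_1$ and is given $M_2$; receiver $\mathrm{D}_2$ must decode $M_2$ and is given $M_1$. Codes for $\mathrm{C}_2$. A $((2^{\mathrm{N}R_1},2^{\mathrm{N}R_2}),\mathrm{N},P_e^{(\mathrm{N})})$ code consists of a deterministic encoder $\mathbf{X}=\mathbf{f}(m_1,m_2,\mathbf{W})\in\mathcal{X}^{\mathrm{N}}$, which uses the entire state sequence (noncausal side-information), and decoders $g_1:\mathcal{Y}_1^{\mathrm{N}}\times\mathcal{M}_2\to\mathcal{M}_1$ and $g_2:\mathcal{Y}_2^{\mathrm{N}}\times\mathcal{M}_1\to\mathcal{M}_2$. The error probability is $P_e^{(\mathrm{N})}=\max\{P_{e,1}^{(\mathrm{N})},P_{e,2}^{(\mathrm{N})}\}$, where $P_{e,1}^{(\mathrm{N})}=\Pr[g_1(\mathbf{Y}_1,M_2)\neq M_1]$ and $P_{e,2}^{(\mathrm{N})}=\Pr[g_2(\mathbf{Y}_2,M_1)\neq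 M_2]$, averaged over the uniform messages and the state sequence. Capacity region. $(R_1,R_2)$ is achievable if there is a sequence of such codes with $P_e^{(\mathrm{N})}\to0$ as $\mathrm{N}\to\infty$. $\mathcal{C}_2$ is the closure of the set of achievable rate pairs. *)

(* Defs.v *)
From mathcomp Require Import all_boot all_order all_algebra.
From mathcomp Require Import all_classical all_reals all_analysis.

Set Implicit Arguments.
Unset Strict Implicit.
Unset Printing Implicit Defensive.

Import Order.TTheory GRing.Theory Num.Theory.
Import numFieldNormedType.Exports.

Local Open Scope classical_set_scope.
Local Open Scope ring_scope.

Record fdist (R : realType) (T : finType) := FDist {
  pmf :> T -> R;
  pmf_ge0 : forall t, 0 <= pmf t;
  pmf_sum1 : \sum_t pmf t = 1
}.

Section FiniteProbability.
Context {R : realType} {T : finType}.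
Implicit Type p : T -> R.

Definition Pr p (E : pred T) : R := \sum_(t | E t) p t.

(* Random variables are functions on the finite sample space [T]. *)
Definition law p {A : finType} (f : T -> A) (a : A) : R :=
  Pr p (fun t => f t == a).

Definition log2 (x : R) : R := ln x / ln 2.

(* Bits.  A term whose joint probability is 0 vanishes, which is the usual
   convention 0 log 0 = 0; otherwise both marginals are positive. *)
Definition mutual_info p {A B : finType} (f : T -> A) (g : T -> B) : R :=
  \sum_(a : A) \sum_(b : B)
    let pab := law p (fun t => (f t, g t)) (a, b) in
    pab * log2 (pab / (law p f a * law p g b)).

End FiniteProbability.


(* The plane is [R^o * R^o], which carries a module and a topological structure. *)
Definition convex_hull (R : realType) (A : set (R^o * R^o)) : set (R^o * R^o) :=
  \bigcap_(C in [set C : set (convex_lmodType (R^o * R^o)%type) |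
                 convex_set C /\ A `<=` C]) C.

Section Channel.
Context {R : realType} {W X Y1 Y2 : finType}.
(* [pW w] is p(w) and [Q x w (y1, y2)] is p(y1, y2 | x, w). *)
Variables (pW : fdist R W) (Q : X -> W -> fdist R (Y1 * Y2)%type).

(* When 2^(N r) is not an integer it is rounded up. *)
Definition num_msg (N : nat) (r : R) : nat :=
  `|Num.ceil (2 `^ (N%:R * r))|%N.

Definition msg (N : nat) (r : R) : finType := 'I_(num_msg N r).

Record bc_code (N : nat) (r1 r2 : R) := BCCode {
  enc : msg N r1 -> msg N r2 -> {ffun 'I_N -> W} -> {ffun 'I_N -> X};
  dec1 : {ffun 'I_N -> Y1} -> msg N r2 -> msg N r1;
  dec2 : {ffun 'I_N -> Y2} -> msg N r1 -> msg N r2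
}.

Section Error.
Context {N : nat} {r1 r2 : R}.
Variable c : bc_code N r1 r2.

Definition outcome : finType :=
  (msg N r1 * msg N r2 * {ffun 'I_N -> W} *
   {ffun 'I_N -> Y1} * {ffun 'I_N -> Y2})%type.

(* The joint law of (M_1, M_2, W^N, Y_1^N, Y_2^N) induced by the code. *)
Definition code_law (t : outcome) : R :=
  let '(m1, m2, w, y1, y2) := t in
  let x := enc c m1 m2 w in
  (num_msg N r1)%:R^-1 * (num_msg N r2)%:R^-1 *
  (\prod_(n < N) pW (w n)) *
  (\prod_(n < N) Q (x n) (w n) (y1 n, y2 n)).

Definition Pe1 : R :=
  Pr code_law (fun '(m1, m2, w, y1, y2) => dec1 c y1 m2 != m1).

Definition Pe2 : R :=
  Pr code_law (fun '(m1, m2, w, y1, y2) => dec2 c y2 m1 != m2).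

Definition Pe : R := Num.max Pe1 Pe2.

End Error.

Definition achievable : set (R^o * R^o) :=
  [set r | 0 <= r.1 /\ 0 <= r.2 /\
    exists c : forall N : nat, bc_code N r.1 r.2,
      (fun N => Pe (c N)) @ \oo --> (0 : R)].

Definition capacity_region : set (R^o * R^o) := closure achievable.

Section Auxiliary.
Variable U : finType.

Definition sample : finType := (W * U * X * Y1 * Y2)%type.

Definition rvW (t : sample) : W := let '(w, u, x, y1, y2) := t in w.
Definition rvU (t : sample) : U := let '(w, u, x, y1, y2) := t in u.
Definition rvY1 (t : sample) : Y1 := let '(w, u, x, y1, y2) := t in y1.
Definition rvY2 (t : sample) : Y2 := let '(w, u, x, y1, y2) := t in y2.

Definition P2 : set (fdist R sample) :=
  [set p | exists (pU : W -> fdist R U) (pX : W -> U -> fdist R X),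
    forall w u x y1 y2,
      p (w, u, x, y1, y2) = pW w * pU w u * pX w u x * Q x w (y1, y2)].

Definition R2in_of (p : fdist R sample) : set (R^o * R^o) :=
  convex_hull [set r : R^o * R^o |
    [/\ (0 : R) <= r.1, (0 : R) <= r.2,
        r.1 <= mutual_info p rvU rvY1 - mutual_info p rvU rvW &
        r.2 <= mutual_info p rvU rvY2 - mutual_info p rvU rvW]].

End Auxiliary.

Definition R2in : set (R^o * R^o) :=
  [set r | exists (U : finType) (p : fdist R (sample U)),
    P2 p /\ R2in_of p r].

End Channel.

(* Main.v *)
Require Import Defs.
From mathcomp Require Import all_boot all_order all_algebra.
From mathcomp Require Import all_classical all_reals all_analysis.
From mathcomp Require Import ring lra.

Set Implicit Arguments.
Unset Strict Implicit.
Unset Printing Implicit Defensive.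

Import Order.TTheory GRing.Theory Num.Theory.
Import numFieldNormedType.Exports.

Local Open Scope ring_scope.

(* A one-shot random coding bound, applied to blocks.  Draw a codebook of independent
   codewords u(m1, m2, l) with law p(u).  Given the state w, pick l with probability
   proportional to the density i(u, w) = p(u, w) / (p(u) p(w)) of u(m1, m2, l), and then
   the channel input with law p(x | w, u).  By Jensen's inequality the pair formed by w
   and the selected codeword has law at least p(w, u) / (1 + i(u, w) / L), so it is close
   to p(w, u) when L exceeds the typical value of i(u, w), that is when the rate of L is
   above I(U; W).  A decoder that knows the other message tests i(u, y) against a
   threshold; a wrong codeword is independent of the output, so it passes with
   probability at most 1 / threshold.  Choosing the best input for each (m1, m2, w) and
   the best codebook makes the encoder deterministic.  On blocks, Chebyshev's inequality
   concentrates the logarithms of the densities at the mutual informations, and all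
   errors are O(1/N).  The rate rectangle is already convex, and lowering positive rates
   slightly makes the rate inequalities strict. *)

(** * Product laws on finite families and the redrawing of one coordinate *)

Definition prod_law {R : realType} {K T : finType} (p : T -> R)
  (c : {ffun K -> T}) : R := \prod_k p (c k).

Definition upd {K T : finType} (c : {ffun K -> T}) (k : K) (u : T) :
  {ffun K -> T} := [ffun j => if j == k then u else c j].

Section ProductLaw.
Context {R : realType} {K T : finType}.
Variable p : T -> R.
Hypothesis p_ge0 : forall t, 0 <= p t.
Hypothesis p_sum1 : \sum_t p t = 1.
Implicit Types (c : {ffun K -> T}) (k : K).

Lemma prod_law_ge0 c : 0 <= prod_law p c.
Proof. exact: prodr_ge0. Qed.

Lemma sum_prod_ffun (F : K -> T -> R) :
  \sum_(c : {ffun K -> T}) \prod_k F k (c k) = \prod_k \sum_t F k t.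
Proof. by rewrite bigA_distr_bigA. Qed.

Lemma sum_prod_law : \sum_(c : {ffun K -> T}) prod_law p c = 1.
Proof.
by rewrite (sum_prod_ffun (fun=> p)) big1.
Qed.

(* (c, u) |-> (c[k := u], c k) is an involution that preserves the weight. *)
Lemma resample k (F : {ffun K -> T} -> R) :
  \sum_c prod_law p c * F c =
  \sum_c prod_law p c * \sum_u p u * F (upd c k u).
Proof.
pose h (x : {ffun K -> T} * T) := (upd x.1 k x.2, x.1 k).
have hK : involutive h.
  move=> [c u]; rewrite /h /=; congr (_, _); last by rewrite ffunE eqxx.
  by apply/ffunP => j; rewrite !ffunE; case: eqP => // ->.
have hw x : prod_law p (h x).1 * p (h x).2 = prod_law p x.1 * p x.2.
  rewrite /prod_law (bigD1 k) //= [in RHS](bigD1 k) //= !ffunE eqxx.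
  rewrite mulrAC [RHS]mulrAC [p (x.1 k) * _]mulrC; congr (_ * _).
  by apply: eq_bigr => j /negPf jk; rewrite !ffunE jk.
transitivity (\sum_x prod_law p x.1 * p x.2 * F x.1).
  rewrite -(pair_bigA _ (fun c u => prod_law p c * p u * F c)) /=.
  apply: eq_bigr => c _; rewrite -mulr_suml -mulr_sumr p_sum1 mulr1 //.
rewrite (reindex_inj (inv_inj hK)) /=.
transitivity (\sum_x prod_law p x.1 * p x.2 * F (upd x.1 k x.2)).
  by apply: eq_bigr => x _; rewrite hw.
rewrite -(pair_bigA _ (fun c u => prod_law p c * p u * F (upd c k u))) /=.
by apply: eq_bigr => c _; rewrite mulr_sumr; apply: eq_bigr => u _; rewrite mulrA.
Qed.

(** Redrawing coordinate [k] leaves [g] unchanged, so the expectation factors. *)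
Lemma expect_indep k (g : {ffun K -> T} -> R) (phi : T -> R) :
  (forall c u, g (upd c k u) = g c) ->
  \sum_c prod_law p c * (g c * phi (c k)) =
  (\sum_c prod_law p c * g c) * \sum_u p u * phi u.
Proof.
move=> gk; rewrite (resample k) mulr_suml; apply: eq_bigr => c _.
rewrite -mulrA; congr (_ * _); rewrite mulr_sumr; apply: eq_bigr => u _.
by rewrite gk ffunE eqxx mulrCA.
Qed.

Lemma expect_coord k (phi : T -> R) :
  \sum_c prod_law p c * phi (c k) = \sum_u p u * phi u.
Proof.
have := @expect_indep k (fun=> 1) phi (fun _ _ => erefl).
under eq_bigr do rewrite mul1r.
by move=> ->; under eq_bigr do rewrite mulr1; rewrite sum_prod_law mul1r.
Qed.

End ProductLaw.

(** * Chebyshev's inequality for sums of i.i.d. terms *)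

Section WeakLaw.
Context {R : realType} {T : finType}.
Variable p : T -> R.
Hypothesis p_ge0 : forall t, 0 <= p t.
Hypothesis p_sum1 : \sum_t p t = 1.

(** Cross terms vanish by independence and centring; each of the [N] diagonal terms contributes the
    one-letter variance. *)
Lemma second_moment (N : nat) (Z : T -> R) : \sum_t p t * Z t = 0 ->
  \sum_(c : {ffun 'I_N -> T}) prod_law p c * (\sum_n Z (c n)) ^+ 2 =
  N%:R * \sum_t p t * Z t ^+ 2.
Proof.
move=> Z0.
transitivity (\sum_(n < N) \sum_(m < N)
    \sum_(c : {ffun 'I_N -> T}) prod_law p c * (Z (c m) * Z (c n))).
  rewrite exchange_big /=; under [RHS]eq_bigr do rewrite exchange_big /=.
  rewrite [RHS]exchange_big /=; apply: eq_bigr => c _.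
  rewrite expr2 mulr_suml mulr_sumr; apply: eq_bigr => n _.
  by rewrite mulr_sumr mulr_sumr.
rewrite -[N in RHS]card_ord mulr_natl -sumr_const; apply: eq_bigr => n _.
rewrite (bigD1 n) //= (expect_coord p_sum1 n (fun t => Z t * Z t)).
rewrite [X in _ + X]big1 ?addr0; first by apply: eq_bigr => t _; rewrite expr2.
move=> m mn; rewrite (@expect_indep _ _ _ _ p_sum1 n (fun c => Z (c m))) ?Z0 ?mulr0 //.
by move=> c u; rewrite ffunE (negPf mn).
Qed.

(** Chebyshev's inequality, with [C] the variance over [delta ^+ 2], uniform in [N] and [E]. The
    deviation is asked for only on outcomes of positive probability, so that [Z] may be the
    logarithm of a density that vanishes elsewhere. *)
Lemma weak_law (Z : T -> R) (delta : R) : 0 < delta -> exists2 C : R, 0 <= C &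
  forall (N : nat) (E : pred {ffun 'I_N -> T}),
    (forall c, E c -> prod_law p c != 0 ->
       N%:R * delta <= `|\sum_n Z (c n) - N%:R * \sum_t p t * Z t|) ->
    N%:R * \sum_(c | E c) prod_law p c <= C.
Proof.
move=> d0; set mu := \sum_t _.
pose Y t := Z t - mu.
exists ((\sum_t p t * Y t ^+ 2) / delta ^+ 2).
  apply: divr_ge0; last exact: exprn_ge0 (ltW d0).
  by apply: sumr_ge0 => t _; rewrite mulr_ge0 ?sqr_ge0.
move=> [|N] E HE.
  rewrite mul0r divr_ge0 ?(exprn_ge0 _ (ltW d0)) //.
  by apply: sumr_ge0 => t _; rewrite mulr_ge0 ?sqr_ge0.
have Y0 : \sum_t p t * Y t = 0.
  rewrite /Y; under eq_bigr do rewrite mulrBr.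
  by rewrite sumrB -/mu -mulr_suml p_sum1 mul1r subrr.
have := second_moment N.+1 Y0; set V := \sum_t _ => HV.
have sY c : \sum_(n < N.+1) Y (c n) = \sum_(n < N.+1) Z (c n) - N.+1%:R * mu.
  by rewrite sumrB sumr_const card_ord mulr_natl.
have N0 : 0 < N.+1%:R :> R by rewrite ltr0n.
rewrite ler_pdivlMr ?exprn_gt0 // -(ler_pM2l N0) -HV.
rewrite [X in X <= _](_ : _ =
   \sum_(c | E c) prod_law p c * (N.+1%:R * delta) ^+ 2); last first.
  by rewrite -mulr_suml; ring.
rewrite big_mkcond /=; apply: ler_sum => c _; case: ifP => Ec.
  have [->|pc0] := eqVneq (prod_law p c) 0; first by rewrite !mul0r.
  apply: ler_wpM2l; first exact: prod_law_ge0.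
  rewrite sY -[X in _ <= X]real_normK ?num_real // ler_sqr ?nnegrE ?HE //.
  by rewrite mulr_ge0 ?ltW.
by rewrite mulr_ge0 ?sqr_ge0 ?prod_law_ge0.
Qed.

End WeakLaw.

(** * The random encoder and its expected error for one message pair *)

(** The convex function 1 / z lies above its tangent at [m]. Averaging this bound over [z] gives
    Jensen's inequality with explicit constants. *)
Lemma inv_tangent (R : realFieldType) (m z : R) : 0 < m -> 0 < z ->
  2 / m - z / m ^+ 2 <= z^-1.
Proof.
move=> m0 z0; rewrite -subr_ge0.
have -> : z^-1 - (2 / m - z / m ^+ 2) = (z - m) ^+ 2 / (z * m ^+ 2).
  by field; rewrite !gt_eqF.
by rewrite divr_ge0 ?sqr_ge0 // mulr_ge0 ?ltW // exprn_gt0.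
Qed.

Section Encoder.
Context {R : realType} {W U X Y K L : finType}.
Variables (pW : W -> R) (pU : U -> R) (d : U -> W -> R).
Variables (pX : W -> U -> X -> R) (Q : X -> W -> Y -> R).
Hypothesis pW_ge0 : forall w, 0 <= pW w.
Hypothesis pW_sum1 : \sum_w pW w = 1.
Hypothesis pU_ge0 : forall u, 0 <= pU u.
Hypothesis pU_sum1 : \sum_u pU u = 1.
Hypothesis d_ge0 : forall u w, 0 <= d u w.
Hypothesis d_le1 : forall w, \sum_u pU u * d u w <= 1.
Hypothesis d_sum1 : \sum_w \sum_u pW w * pU u * d u w = 1.
Hypothesis pX_ge0 : forall w u x, 0 <= pX w u x.
Hypothesis pX_sum1 : forall w u, \sum_x pX w u x = 1.
Hypothesis Q_ge0 : forall x w y, 0 <= Q x w y.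
Hypothesis Q_sum1 : forall x w, \sum_y Q x w y = 1.
Variable own : L -> K.
Hypothesis own_inj : injective own.
Hypothesis L_gt0 : (0 < #|L|)%N.

Implicit Types (c : {ffun K -> U}) (w : W) (l : L).

Let P c := prod_law pU c.

(** The likelihood encoder; [own] embeds the indices of the codewords of the message pair being sent
    into the whole codebook. If all their densities vanish, division by zero makes every weight 0,
    so the weights form only a subprobability. *)
Definition coder c w l : R := d (c (own l)) w / \sum_l' d (c (own l')) w.

(** The conditional expectation of [A] at the channel output, given state [w] and codeword [u]. *)
Definition fwd (A : Y -> R) w u : R := \sum_x pX w u x * \sum_y Q x w y * A y.

Lemma coder_ge0 c w l : 0 <= coder c w l.
Proof. by rewrite divr_ge0 ?sumr_ge0. Qed.

Lemma sum_coder_le1 c w : \sum_l coder c w l <= 1.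
Proof.
rewrite -mulr_suml; set S := \sum_l _.
by have [->|S0] := eqVneq S 0; rewrite ?mul0r // divff.
Qed.

Lemma fwd_ge0 (A : Y -> R) w u : (forall y, 0 <= A y) -> 0 <= fwd A w u.
Proof.
move=> A0; apply: sumr_ge0 => x _; rewrite mulr_ge0 //.
by apply: sumr_ge0 => y _; rewrite mulr_ge0.
Qed.

Lemma fwd_cst (a : R) w u : fwd (fun=> a) w u = a.
Proof.
rewrite /fwd; under eq_bigr do rewrite -mulr_suml Q_sum1 mul1r.
by rewrite -mulr_suml pX_sum1 mul1r.
Qed.

Lemma fwd_le (A : Y -> R) (b : R) w u : (forall y, A y <= b) -> fwd A w u <= b.
Proof.
move=> Ab; rewrite /fwd -[leRHS]mul1r -(pX_sum1 w u) mulr_suml.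
apply: ler_sum => x _; rewrite ler_wpM2l // -[leRHS]mul1r -(Q_sum1 x w) mulr_suml.
by apply: ler_sum => y _; rewrite ler_wpM2l.
Qed.

(* Jensen's inequality for 1 / z: the selected codeword has law at least
   pU u * d u w * L / (d u w + L). *)
Lemma coder_covers w l (phi : U -> R) : (forall u, 0 <= phi u) ->
  \sum_u pU u * d u w * phi u / (d u w + #|L|%:R) <=
  \sum_c P c * (coder c w l * phi (c (own l))).
Proof.
move=> phi0; rewrite (resample pU_sum1 (own l)).
pose S c := \sum_(l' | l' != l) d (c (own l')) w.
have S0 c : 0 <= S c by apply: sumr_ge0.
rewrite [leRHS](_ : _ = \sum_u pU u * d u w * phi u *
    \sum_c P c * (d u w + S c)^-1); last first.
  under [RHS]eq_bigr do rewrite mulr_sumr.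
  rewrite exchange_big /=; apply: eq_bigr => c _.
  rewrite mulr_sumr; apply: eq_bigr => u _.
  rewrite /coder (bigD1 l) //= !ffunE eqxx.
  under eq_bigr => l' /negPf l'l do
    rewrite ffunE (inj_eq own_inj) l'l.
  rewrite -/(S c) -/(P c); ring.
apply: ler_sum => u _; have [->|du] := eqVneq (d u w) 0; first by rewrite !(mulr0, mul0r).
have {}du : 0 < d u w by rewrite lt_neqAle eq_sym du d_ge0.
apply: ler_wpM2l; first by rewrite !mulr_ge0.
(* The tangent point [m] bounds the mean of [d u w + S c] from above, each competitor having mean
   density at most 1. The tangent has negative slope, so this one-sided bound suffices. *)
set m := d u w + _.
have m0 : 0 < m by rewrite ltr_wpDr.
have ES : \sum_c P c * S c <= #|L|%:R.
  under eq_bigr do rewrite mulr_sumr.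
  rewrite exchange_big /= -[#|L|%:R]mulr_natl mulr1.
  rewrite -sum1_card natr_sum [leRHS](bigD1 l) //= -[leLHS]add0r lerD //.
  apply: ler_sum => l' _.
  by rewrite (expect_coord pU_sum1 (own l') (d^~ w)).
apply: le_trans (_ : \sum_c P c * (2 / m - (d u w + S c) / m ^+ 2) <= _); last first.
  apply: ler_sum => c _; apply: ler_wpM2l; first exact: prod_law_ge0.
  by apply: inv_tangent => //; rewrite ltr_wpDr.
have -> : \sum_c P c * (2 / m - (d u w + S c) / m ^+ 2) =
   2 / m - (d u w + \sum_c P c * S c) / m ^+ 2.
  transitivity (\sum_c (P c * (2 / m - d u w / m ^+ 2) - P c * S c / m ^+ 2)).
    by apply: eq_bigr => c _; ring.
  rewrite sumrB -!mulr_suml sum_prod_law //; ring.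
rewrite -subr_ge0.
have -> : 2 / m - (d u w + \sum_c P c * S c) / m ^+ 2 - m^-1 =
  (#|L|%:R - \sum_c P c * S c) / m ^+ 2.
  by rewrite /m; field; rewrite gt_eqF.
by rewrite divr_ge0 ?subr_ge0 // ltW // exprn_gt0.
Qed.

(** Summing [coder_covers] over [l] gives the factor L / (d + L), where d is the density and L the
    number of codewords. It is at least 1 - tau / L if d is at most [tau]; otherwise the summand on
    the left is at most 0, because [phi] is at most 2. *)
Lemma coder_typical w (tau : R) (phi : U -> R) : 0 < tau ->
  (forall u, 0 <= phi u <= 2) ->
  \sum_u pU u * d u w * (phi u - 2 * (tau / #|L|%:R + (tau < d u w)%R%:R)) <=
  \sum_c P c * \sum_l coder c w l * phi (c (own l)).
Proof.
move=> tau0 phi02.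
under [leRHS]eq_bigr do rewrite mulr_sumr.
rewrite exchange_big /=.
have L0 : 0 < #|L|%:R :> R by rewrite ltr0n.
apply: le_trans (_ : \sum_(l : L) \sum_u pU u * d u w * phi u / (d u w + #|L|%:R) <= _);
  last first.
  by apply: ler_sum => l _; apply: coder_covers => u; have /andP[] := phi02 u.
rewrite exchange_big /=; apply: ler_sum => u _.
rewrite sumr_const -[leRHS]mulr_natl.
rewrite [leRHS](_ : _ = pU u * d u w * (phi u * (#|L|%:R / (d u w + #|L|%:R)))); last by ring.
apply: ler_wpM2l; first exact: mulr_ge0.
have /andP[p0 p2] := phi02 u; have dw := d_ge0 u w.
set D := d u w in dw *; set l := #|L|%:R in L0 *.
have Dl : 0 < D + l by rewrite ltr_wpDl.
have r1 : 0 <= l / (D + l) by rewrite divr_ge0 ?ltW.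
have t0 : 0 < tau / l by rewrite divr_gt0.
have [Dt|Dt] := ltP tau D.
  apply: le_trans (mulr_ge0 p0 r1); rewrite /= mulr1n; lra.
have r2 : 1 - tau / l <= l / (D + l).
  rewrite -subr_ge0.
  have -> : l / (D + l) - (1 - tau / l) = (tau * (D + l) - D * l) / (l * (D + l)).
    by field; rewrite !gt_eqF.
    apply: divr_ge0; last by rewrite mulr_ge0 ?ltW.
  have := mulr_ge0 (ltW tau0) dw.
  have : 0 <= l * (tau - D) by rewrite mulr_ge0 ?subr_ge0 // ltW.
  nra.
rewrite /= addr0; apply: le_trans (_ : phi u * (1 - tau / l) <= _).
  by have := ler_wpM2r (ltW t0) p2; lra.
exact: ler_wpM2l.
Qed.

(* [e c w] is the error of the best channel input for the state [w], so it is at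
   most the error when the input is drawn from any of the codewords [c (own l)]. *)
Lemma random_coding (tau beta : R) (A : U -> Y -> R) (B : {ffun K -> U} -> Y -> R)
    (e : {ffun K -> U} -> W -> R) : 0 < tau ->
  (forall u y, 0 <= A u y <= 2) ->
  (forall c w, e c w <= 2) ->
  (forall c w l, e c w <= fwd (fun y => A (c (own l)) y + B c y) w (c (own l))) ->
  0 <= beta ->
  (forall (g : {ffun K -> U} -> R) y, (forall c, 0 <= g c) ->
     (forall c c', (forall l, c (own l) = c' (own l)) -> g c = g c') ->
     \sum_c P c * (g c * B c y) <= beta * \sum_c P c * g c) ->
  \sum_c P c * \sum_w pW w * e c w <=
  \sum_w \sum_u pW w * pU u * d u w * fwd (A u) w u +
  2 * (tau / #|L|%:R + \sum_w \sum_(u | tau < d u w) pW w * pU u * d u w) + beta.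
Proof.
move=> tau0 A02 e2 eAB beta0 HB.
(* [coder_typical] bounds expectations from below, so the error enters through its complement to 2.
   The mass missing from [coder] is charged the full error 2. *)
have e_le c w : e c w <= 2 - \sum_l coder c w l * (2 - fwd (A (c (own l))) w (c (own l)))
    + \sum_l coder c w l * fwd (B c) w (c (own l)).
  have -> : 2 - \sum_l coder c w l * (2 - fwd (A (c (own l))) w (c (own l)))
    + \sum_l coder c w l * fwd (B c) w (c (own l)) =
    2 * (1 - \sum_l coder c w l) +
    \sum_l coder c w l * fwd (fun y => A (c (own l)) y + B c y) w (c (own l)).
    have -> : \sum_l coder c w l * fwd (fun y => A (c (own l)) y + B c y) w (c (own l))
       = \sum_l coder c w l * fwd (A (c (own l))) w (c (own l)) +
         \sum_l coder c w l * fwd (B c) w (c (own l)).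
      rewrite -big_split; apply: eq_bigr => l _ /=.
      rewrite -mulrDr; congr (_ * _); rewrite /fwd -big_split; apply: eq_bigr => x _ /=.
      rewrite -mulrDr; congr (_ * _); rewrite -big_split; apply: eq_bigr => y _ /=.
      by rewrite mulrDr.
    under eq_bigr do rewrite mulrBr.
    rewrite sumrB -mulr_suml; ring.
  rewrite -[leLHS](_ : e c w * (1 - \sum_l coder c w l) + \sum_l coder c w l * e c w = _); last first.
    by rewrite -mulr_suml; ring.
  apply: lerD; first by rewrite ler_wpM2r // subr_ge0 sum_coder_le1.
  by apply: ler_sum => l _; rewrite ler_wpM2l ?coder_ge0.
have interf w : \sum_c P c * \sum_l coder c w l * fwd (B c) w (c (own l)) <= beta.
  (* The weight of selecting [l], sending [x] and receiving [y]. It depends on the codebook only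
     through the codewords [c (own l)], as the hypothesis on [B] demands. *)
  pose g l x y c := coder c w l * (pX w (c (own l)) x * Q x w y).
  have -> : \sum_c P c * \sum_l coder c w l * fwd (B c) w (c (own l)) =
    \sum_l \sum_x \sum_y \sum_c P c * (g l x y c * B c y).
    under eq_bigr do rewrite mulr_sumr.
    rewrite exchange_big; apply: eq_bigr => l _ /=.
    under [RHS]eq_bigr do rewrite exchange_big.
    rewrite /= [RHS]exchange_big; apply: eq_bigr => c _ /=.
    rewrite !mulr_sumr; apply: eq_bigr => x _; rewrite !mulr_sumr.
    by apply: eq_bigr => y _; rewrite /g; ring.
  apply: le_trans (_ : \sum_l \sum_x \sum_y beta * \sum_c P c * g l x y c <= _).
    do 3! (apply: ler_sum => ? _); apply: HB => [c|c c' cc'].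
      by apply: mulr_ge0; [exact: coder_ge0|exact: mulr_ge0].
    rewrite /g /coder cc'; congr (_ / _ * _).
    by apply: eq_bigr => l' _; rewrite cc'.
  have -> : \sum_l \sum_x \sum_y beta * \sum_c P c * g l x y c =
     beta * \sum_c P c * \sum_l coder c w l.
    transitivity (beta * \sum_l \sum_x \sum_y \sum_c P c * g l x y c).
      rewrite mulr_sumr; apply: eq_bigr => l _; rewrite mulr_sumr.
      by apply: eq_bigr => x _; rewrite mulr_sumr.
    congr (_ * _); under [RHS]eq_bigr do rewrite mulr_sumr.
    rewrite [RHS]exchange_big; apply: eq_bigr => l _ /=.
    under eq_bigr do rewrite exchange_big.
    rewrite /= exchange_big; apply: eq_bigr => c _ /=.
    transitivity (\sum_x P c * (coder c w l * pX w (c (own l)) x)).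
      apply: eq_bigr => x _; rewrite -mulr_sumr; congr (_ * _).
      rewrite /g -mulr_sumr; congr (_ * _).
      by rewrite -mulr_sumr Q_sum1 mulr1.
    by rewrite -!mulr_sumr pX_sum1 mulr1.
  rewrite -[leRHS]mulr1 ler_wpM2l // -(@sum_prod_law _ K _ _ pU_sum1).
  apply: ler_sum => c _; rewrite -[leRHS]mulr1.
  by rewrite ler_wpM2l ?prod_law_ge0 ?sum_coder_le1.
have sel w : \sum_u pU u * d u w *
      (2 - fwd (A u) w u - 2 * (tau / #|L|%:R + (tau < d u w)%R%:R)) <=
    \sum_c P c * \sum_l coder c w l * (2 - fwd (A (c (own l))) w (c (own l))).
  apply: (@coder_typical w tau (fun u => 2 - fwd (A u) w u)) => // u.
  have := @fwd_ge0 (A u) w u; have := @fwd_le (A u) 2 w u.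
  move=> H1 H2; rewrite lerBlDr lerDl subr_ge0 H1 ?H2 // => y;
  by have /andP[] := A02 u y.
have main w : \sum_c P c * e c w <= 2 - \sum_u pU u * d u w *
      (2 - fwd (A u) w u - 2 * (tau / #|L|%:R + (tau < d u w)%R%:R)) + beta.
  apply: le_trans (_ : 2 - \sum_c P c * \sum_l coder c w l *
     (2 - fwd (A (c (own l))) w (c (own l))) +
     \sum_c P c * \sum_l coder c w l * fwd (B c) w (c (own l)) <= _); last first.
    by apply: lerD => //; rewrite lerD2l lerN2.
  have P2 : \sum_c P c * 2 = 2 by rewrite -mulr_suml sum_prod_law // mul1r.
  rewrite -[X in _ <= X - _ + _]P2.
  rewrite -sumrB -big_split; apply: ler_sum => c _ /=.
  have := ler_wpM2l (prod_law_ge0 pU_ge0 c) (e_le c w).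
  by rewrite mulrDr mulrBr.
have -> : \sum_c P c * \sum_w pW w * e c w = \sum_w pW w * \sum_c P c * e c w.
  under eq_bigr do rewrite mulr_sumr.
  rewrite exchange_big; apply: eq_bigr => w _ /=.
  by rewrite mulr_sumr; apply: eq_bigr => c _; rewrite mulrCA.
apply: le_trans (_ : \sum_w pW w * (2 - \sum_u pU u * d u w *
      (2 - fwd (A u) w u - 2 * (tau / #|L|%:R + (tau < d u w)%R%:R)) + beta) <= _).
  by apply: ler_sum => w _; rewrite ler_wpM2l.
set a := \sum_w \sum_u _ ; set q := \sum_w \sum_(u | _) _.
have -> : a = \sum_w pW w * \sum_u pU u * d u w * fwd (A u) w u.
  apply: eq_bigr => w _; rewrite mulr_sumr; apply: eq_bigr => u _; ring.
have -> : q = \sum_w pW w * \sum_u pU u * d u w * (tau < d u w)%R%:R.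
  apply: eq_bigr => w _; rewrite big_mkcond mulr_sumr; apply: eq_bigr => u _.
  by case: ifP => _; rewrite ?mulr1 ?mulr0 ?mulrA.
have s1 : \sum_w pW w * \sum_u pU u * d u w = 1.
  rewrite -d_sum1; apply: eq_bigr => w _; rewrite mulr_sumr.
  by apply: eq_bigr => u _; rewrite mulrA.
set t := tau / _ in sel main *.
have -> : \sum_w pW w * (2 - \sum_u pU u * d u w *
      (2 - fwd (A u) w u - 2 * (t + (tau < d u w)%R%:R)) + beta) =
  (\sum_w pW w) * (2 + beta) - (2 - 2 * t) * \sum_w pW w * (\sum_u pU u * d u w) +
   \sum_w pW w * (\sum_u pU u * d u w * fwd (A u) w u) +
   2 * \sum_w pW w * \sum_u pU u * d u w * (tau < d u w)%R%:R.
  rewrite mulr_suml !mulr_sumr -sumrB -!big_split; apply: eq_bigr => w _ /=.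
  have -> : \sum_u pU u * d u w * (2 - fwd (A u) w u - 2 * (t + (tau < d u w)%R%:R)) =
    (2 - 2 * t) * (\sum_u pU u * d u w) - (\sum_u pU u * d u w * fwd (A u) w u) -
    2 * \sum_u pU u * d u w * (tau < d u w)%R%:R.
    by rewrite !mulr_sumr -!sumrB; apply: eq_bigr => u _; ring.
  ring.
by rewrite s1 pW_sum1; lra.
Qed.

End Encoder.

(** * Decoding, derandomization and the one-shot bound for two receivers *)

Lemma natr_bool_le1 (R : numDomainType) (b : bool) : b%:R <= 1 :> R.
Proof. by rewrite lern1 leq_b1. Qed.

(** The derandomization step, used once for the channel input and once for the codebook. *)
Lemma argmin_le_mean (R : realType) (T : finType) (t0 : T) (q f : T -> R) :
  (forall t, 0 <= q t) -> \sum_t q t = 1 ->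
  f [arg min_(t < t0) f t]%O <= \sum_t q t * f t.
Proof.
move=> q0 q1; case: arg_minP => // t _ ft.
rewrite -[leLHS]mul1r -q1 mulr_suml.
by apply: ler_sum => s _; rewrite ler_wpM2l ?ft.
Qed.

Definition decode (K : finType) (S : pred K) (k0 : K) : K :=
  odflt k0 [pick k | S k].

(** A union bound: if [m] passes the test and nothing else does, the pick can only be [m]. *)
Lemma decode_err (R : realType) (K : finType) (S : pred K) (k0 m : K) :
  (decode S k0 != m)%:R <= (~~ S m)%:R + \sum_(k | k != m) (S k)%:R :> R.
Proof.
rewrite /decode; case: pickP => [k Sk|S0] /=; last first.
  by rewrite S0 /= (le_trans (natr_bool_le1 _ _)) // lerDl sumr_ge0.
case: (boolP (k != m)) => km; last by rewrite addr_ge0 ?sumr_ge0.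
by rewrite (bigD1 k) //= Sk addrCA lerDl addr_ge0 ?sumr_ge0.
Qed.

Section OneShot.
Context {R : realType} {W U X Y1 Y2 K1 K2 L : finType}.
Variables (pW : W -> R) (pU : U -> R) (d : U -> W -> R).
Variables (pX : W -> U -> X -> R) (Q : X -> W -> Y1 * Y2 -> R).
Hypothesis pW_ge0 : forall w, 0 <= pW w.
Hypothesis pW_sum1 : \sum_w pW w = 1.
Hypothesis pU_ge0 : forall u, 0 <= pU u.
Hypothesis pU_sum1 : \sum_u pU u = 1.
Hypothesis d_ge0 : forall u w, 0 <= d u w.
Hypothesis d_le1 : forall w, \sum_u pU u * d u w <= 1.
Hypothesis d_sum1 : \sum_w \sum_u pW w * pU u * d u w = 1.
Hypothesis pX_ge0 : forall w u x, 0 <= pX w u x.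
Hypothesis pX_sum1 : forall w u, \sum_x pX w u x = 1.
Hypothesis Q_ge0 : forall x w y, 0 <= Q x w y.
Hypothesis Q_sum1 : forall x w, \sum_y Q x w y = 1.
Hypothesis L_gt0 : (0 < #|L|)%N.
Variables (T1 : U -> pred Y1) (T2 : U -> pred Y2) (b1 b2 : R).
Hypothesis T1_rare : forall y, \sum_u pU u * (T1 u y)%:R <= b1.
Hypothesis T2_rare : forall y, \sum_u pU u * (T2 u y)%:R <= b2.

Definition atypical (u : U) (y : Y1 * Y2) : R :=
  (~~ T1 u y.1)%:R + (~~ T2 u y.2)%:R.

Let K : finType := (K1 * K2 * L)%type.
Let P (c : {ffun K -> U}) := prod_law pU c.

(* [g] is the weight of the events that produce the output; it does not see the
   codewords of other messages. *)
Lemma wrong_codewords (I : finType) (S : pred I) (key : I * L -> K)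
    (T : U -> bool) (b : R) (g : {ffun K -> U} -> R) :
  \sum_u pU u * (T u)%:R <= b -> (forall c, 0 <= g c) ->
  (forall i l c u, S i -> g (upd c (key (i, l)) u) = g c) ->
  \sum_c P c * (g c * \sum_(i | S i) \sum_l (T (c (key (i, l))))%:R) <=
  (#|S| * #|L|)%:R * b * \sum_c P c * g c.
Proof.
move=> Tb g0 gS.
have -> : \sum_c P c * (g c * \sum_(i | S i) \sum_l (T (c (key (i, l))))%:R) =
   \sum_(i | S i) \sum_l \sum_c P c * (g c * (T (c (key (i, l))))%:R).
  under [RHS]eq_bigr do rewrite exchange_big.
  rewrite /= [RHS]exchange_big; apply: eq_bigr => c _ /=.
  rewrite !mulr_sumr; apply: eq_bigr => i _.
  by rewrite !mulr_sumr.
apply: le_trans (_ : \sum_(i | S i) \sum_(l : L) b * \sum_c P c * g c <= _).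
  apply: ler_sum => i Si; apply: ler_sum => l _.
  rewrite (@expect_indep _ _ _ _ pU_sum1 (key (i, l)) g (fun u => (T u)%:R)); last first.
    by move=> c u; apply: gS.
  rewrite mulrC ler_wpM2r // sumr_ge0 // => c _.
  by rewrite mulr_ge0 ?prod_law_ge0.
by rewrite !sumr_const -mulrnA mulnC -mulrA mulr_natl.
Qed.

(** The three lines of the bound account for a failed test under the ideal law of state, codeword
    and output, for the failure to cover the state, and for wrong codewords that pass a test. *)
Lemma one_shot (tau : R) (k1 : K1) (k2 : K2) : 0 < tau ->
  exists (enc : K1 -> K2 -> W -> X) (dec1 : Y1 -> K2 -> K1) (dec2 : Y2 -> K1 -> K2),
  \sum_m1 \sum_m2 #|K1|%:R^-1 * #|K2|%:R^-1 * \sum_w pW w *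
    \sum_y Q (enc m1 m2 w) w y *
      ((dec1 y.1 m2 != m1)%:R + (dec2 y.2 m1 != m2)%:R) <=
  \sum_w \sum_u pW w * pU u * d u w * fwd pX Q (atypical u) w u +
  2 * (tau / #|L|%:R + \sum_w \sum_(u | tau < d u w) pW w * pU u * d u w) +
  ((#|K1|.-1 * #|L|)%:R * b1 + (#|K2|.-1 * #|L|)%:R * b2).
Proof.
move=> tau0.
(* Total mass 1 forces a nonempty type, which supplies starting points for [arg min]. *)
have inh (T : finType) (q : T -> R) : \sum_t q t = 1 -> inhabited T.
  move=> q1; case: (pickP (@predT T)) => [t _|T0]; first exact: inhabits.
  by move: q1; rewrite big_pred0 // => /esym/eqP; rewrite oner_eq0.
have [u0] := inh _ _ pU_sum1; have [w0] := inh _ _ pW_sum1.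
have [x0] := inh _ _ (pX_sum1 w0 u0).
(* The receiver does not know the selected index, so a message is accepted as soon as one of its
   codewords passes. *)
pose dec1 (c : {ffun K -> U}) y m2 :=
  decode (fun m1 => [exists l, T1 (c (m1, m2, l)) y]) k1.
pose dec2 (c : {ffun K -> U}) y m1 :=
  decode (fun m2 => [exists l, T2 (c (m1, m2, l)) y]) k2.
pose err c m1 m2 (y : Y1 * Y2) : R :=
  (dec1 c y.1 m2 != m1)%:R + (dec2 c y.2 m1 != m2)%:R.
pose f c m1 m2 w x := \sum_y Q x w y * err c m1 m2 y.
pose enc c m1 m2 w := [arg min_(x < x0) f c m1 m2 w x]%O.
pose e c m1 m2 w := f c m1 m2 w (enc c m1 m2 w).
pose bnd := \sum_w \sum_u pW w * pU u * d u w * fwd pX Q (atypical u) w u +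
  2 * (tau / #|L|%:R + \sum_w \sum_(u | tau < d u w) pW w * pU u * d u w) +
  ((#|K1|.-1 * #|L|)%:R * b1 + (#|K2|.-1 * #|L|)%:R * b2).
have err2 c m1 m2 y : err c m1 m2 y <= 2 by apply: lerD; apply: natr_bool_le1.
have avg m1 m2 : \sum_c P c * \sum_w pW w * e c m1 m2 w <= bnd.
  (* The number of wrong codewords that pass; each receiver scans only the pairs compatible with the
     message it knows. *)
  pose B (c : {ffun K -> U}) (y : Y1 * Y2) : R :=
    \sum_(m | m != m1) \sum_l (T1 (c (m, m2, l)) y.1)%:R +
    \sum_(m | m != m2) \sum_l (T2 (c (m1, m, l)) y.2)%:R.
  have b0 (Y : finType) (T : U -> pred Y) b (y : Y) :
      (forall y, \sum_u pU u * (T u y)%:R <= b) -> 0 <= b.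
    by move=> /(_ y); apply: le_trans; apply: sumr_ge0 => u _; rewrite mulr_ge0.
  have [[y1 y2]] := inh _ _ (Q_sum1 x0 w0).
  have b10 := b0 _ _ _ y1 T1_rare; have b20 := b0 _ _ _ y2 T2_rare.
  have own_inj : injective (fun l : L => (m1, m2, l) : K) by move=> l l' [].
  apply: (@random_coding _ _ _ _ _ _ _ _ _ _ _ _ pW_ge0 pW_sum1 pU_ge0 pU_sum1
    d_ge0 d_le1 d_sum1 pX_ge0 pX_sum1 Q_ge0 Q_sum1 _ own_inj L_gt0 _ _ atypical B)
    => //.
  - by move=> u y; rewrite addr_ge0 //= /atypical -[2]/(1 + 1) lerD ?natr_bool_le1.
  - move=> c w; rewrite [leRHS](_ : 2 = \sum_y Q (enc c m1 m2 w) w y * 2); last first.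
      by rewrite -mulr_suml Q_sum1 mul1r.
    by apply: ler_sum => y _; apply: ler_wpM2l; [exact: Q_ge0|exact: err2].
  - move=> c w l; apply: le_trans (argmin_le_mean _ _ (pX_ge0 w (c (m1, m2, l))) (pX_sum1 _ _)) _.
    apply: ler_sum => x _; rewrite ler_wpM2l //; apply: ler_sum => y _.
    rewrite ler_wpM2l // /err /atypical /B addrACA.
    have single (Km Y : finType) (T : U -> pred Y) (key : Km -> L -> K) k0 m y' :
        (decode (fun m => [exists l, T (c (key m l)) y']) k0 != m)%:R <=
        (~~ T (c (key m l)) y')%:R +
        \sum_(m' | m' != m) \sum_l (T (c (key m' l)) y')%:R :> R.
      apply: le_trans (decode_err _ _ _ _) _; apply: lerD.
        case: existsP => [_|nex]; first exact: ler0n.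
        by rewrite (_ : T _ _ = false) //; apply/negP => Tl; apply: nex; exists l.
      apply: ler_sum => m' _; case: existsP => [[l' Tl']|_]; last by rewrite sumr_ge0.
      by rewrite (bigD1 l') //= Tl' lerDl sumr_ge0.
    apply: lerD; first exact: (single _ _ T1 (fun m l => (m, m2, l))).
    exact: (single _ _ T2 (fun m l => (m1, m, l))).
  - by rewrite addr_ge0 // mulr_ge0.
  move=> g y g0 gown; rewrite mulrDl.
  under eq_bigr do rewrite /B mulrDr mulrDr.
  rewrite big_split /=.
  have gupd c k u : (forall l, k != (m1, m2, l)) -> g (upd c k u) = g c.
    by move=> kl; apply: gown => l; rewrite ffunE eq_sym (negPf (kl l)).
  have := @wrong_codewords K1 (predC1 m1) (fun ml => (ml.1, m2, ml.2)) (T1^~ y.1) b1 g.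
  have := @wrong_codewords K2 (predC1 m2) (fun ml => (m1, ml.1, ml.2)) (T2^~ y.2) b2 g.
  rewrite !cardC1 => H2 H1; apply: lerD; [apply: H1|apply: H2] => // i l c u im;
    apply: gupd => l' /=; apply: contra im => /eqP[-> //].
pose tot c := \sum_m1 \sum_m2 #|K1|%:R^-1 * #|K2|%:R^-1 * \sum_w pW w * e c m1 m2 w.
have c0 : {ffun K -> U} := [ffun=> u0].
(* One codebook must serve all message pairs, so the minimum is taken of the error averaged over the
   pairs. *)
pose c := [arg min_(c < c0) tot c]%O.
exists (enc c), (dec1 c), (dec2 c).
apply: (@le_trans _ _ (tot c)).
  by [].
apply: le_trans (argmin_le_mean _ _ (prod_law_ge0 pU_ge0) (sum_prod_law pU_sum1)) _.
have -> : \sum_c P c * tot c = \sum_m1 \sum_m2 #|K1|%:R^-1 * #|K2|%:R^-1 *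
   \sum_c P c * \sum_w pW w * e c m1 m2 w.
  under eq_bigr do rewrite mulr_sumr.
  rewrite exchange_big; apply: eq_bigr => m1 _ /=.
  under eq_bigr do rewrite mulr_sumr.
  rewrite exchange_big; apply: eq_bigr => m2 _ /=.
  by rewrite mulr_sumr; apply: eq_bigr => c' _; rewrite mulrCA.
have mean (I : finType) (i : I) (b : R) : \sum_(j : I) #|I|%:R^-1 * b = b.
  have I0 : #|I|%:R != 0 :> R by rewrite pnatr_eq0 -lt0n; apply/card_gt0P; exists i.
  by rewrite -mulr_suml sumr_const -[_ *+ _]mulr_natr mulVf ?mul1r.
rewrite -/bnd -[leRHS](mean K1 k1); apply: ler_sum => m1 _.
rewrite -[X in _ <= _ * X](mean K2 k2) mulr_sumr; apply: ler_sum => m2 _.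
by rewrite mulrA ler_wpM2l ?mulr_ge0 ?invr_ge0.
Qed.

End OneShot.

(** * Powers of two *)

Section Pow2.
Context {R : realType}.

Lemma ln2_gt0 : 0 < ln 2 :> R.
Proof. by rewrite ln_gt0 // ltr1n. Qed.

Lemma pow2E (x : R) : 2 `^ x = expR (x * ln 2).
Proof. by rewrite /powR pnatr_eq0. Qed.

Lemma ltr_pow2 (x y : R) : (2 `^ x < 2 `^ y) = (x < y).
Proof. by rewrite !pow2E ltr_expR ltr_pM2r // ln2_gt0. Qed.

Lemma ler_pow2 (x y : R) : (2 `^ x <= 2 `^ y) = (x <= y).
Proof. by rewrite !pow2E ler_expR ler_pM2r // ln2_gt0. Qed.

Lemma pow2_gt0 (x : R) : 0 < 2 `^ x.
Proof. by rewrite pow2E expR_gt0. Qed.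

Lemma pow2D (x y : R) : 2 `^ (x + y) = 2 `^ x * 2 `^ y.
Proof. by rewrite !pow2E mulrDl expRD. Qed.

Lemma pow2_log2 (x : R) : 0 < x -> 2 `^ (log2 x) = x.
Proof. by move=> x0; rewrite pow2E divfK ?lnK // gt_eqF // ln2_gt0. Qed.

Lemma pow2_sum (I : finType) (F : I -> R) : 2 `^ (\sum_i F i) = \prod_i 2 `^ (F i).
Proof.
rewrite pow2E mulr_suml expR_sum; apply: eq_bigr => i _; by rewrite pow2E.
Qed.

(** Since exp x is at least 1 + x, exponentially small terms are O(1/N), the scale of Chebyshev's
    inequality. *)
Lemma nat_pow2_le (N : nat) (delta : R) : 0 < delta ->
  N%:R * 2 `^ (- (N%:R * delta)) <= (delta * ln 2)^-1.
Proof.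
move=> d0; have dl : 0 < delta * ln 2 by rewrite mulr_gt0 ?ln2_gt0.
rewrite pow2E mulNr expRN -mulrA ler_pdivrMr ?expR_gt0 //.
rewrite mulrC ler_pdivlMr //; apply: le_trans (expR_ge1Dx _).
by rewrite lerDr.
Qed.

End Pow2.

(** * Information densities and mutual information *)

Section Density.
Context {R : realType} {T A B : finType}.
Variable p : T -> R.
Hypothesis p_ge0 : forall t, 0 <= p t.
Hypothesis p_sum1 : \sum_t p t = 1.

Lemma law_ge0 (C : finType) (h : T -> C) a : 0 <= law p h a.
Proof. exact: sumr_ge0. Qed.

Lemma expect_law (C : finType) (h : T -> C) (phi : C -> R) :
  \sum_t p t * phi (h t) = \sum_a law p h a * phi a.
Proof.
rewrite (partition_big h xpredT) //=; apply: eq_bigr => a _.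
by rewrite /law /Pr mulr_suml; apply: eq_bigr => t /eqP ->.
Qed.

Lemma sum_law (C : finType) (h : T -> C) : \sum_a law p h a = 1.
Proof.
rewrite -p_sum1; transitivity (\sum_a law p h a * 1).
  by apply: eq_bigr => a _; rewrite mulr1.
by rewrite -(expect_law h (fun=> 1)); apply: eq_bigr => t _; rewrite mulr1.
Qed.

Variables (f : T -> A) (g : T -> B).

Lemma law_marginal_l a : \sum_b law p (fun t => (f t, g t)) (a, b) = law p f a.
Proof.
by rewrite /law /Pr [RHS](partition_big g xpredT).
Qed.

Lemma law_marginal_r b : \sum_a law p (fun t => (f t, g t)) (a, b) = law p g b.
Proof.
rewrite /law /Pr [RHS](partition_big f xpredT) //=; apply: eq_bigr => a _.
by apply: eq_bigl => t; rewrite xpair_eqE andbC.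
Qed.

(** Its base-2 logarithm is the information density. Division by zero gives it the value 0 where a
    marginal vanishes. *)
Definition dens (a : A) (b : B) : R :=
  law p (fun t => (f t, g t)) (a, b) / (law p f a * law p g b).

Lemma dens_ge0 a b : 0 <= dens a b.
Proof. by rewrite divr_ge0 ?mulr_ge0 ?law_ge0. Qed.

Lemma law_pair_le_l a b : law p (fun t => (f t, g t)) (a, b) <= law p f a.
Proof.
rewrite -law_marginal_l [leRHS](bigD1 b) //= lerDl.
by apply: sumr_ge0 => b' _; apply: law_ge0.
Qed.

Lemma law_pair_le_r a b : law p (fun t => (f t, g t)) (a, b) <= law p g b.
Proof.
rewrite -law_marginal_r [leRHS](bigD1 a) //= lerDl.
by apply: sumr_ge0 => a' _; apply: law_ge0.
Qed.

(** Where a marginal vanishes so does the joint law, hence the default value 0 is harmless. *)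
Lemma dens_joint a b :
  law p f a * law p g b * dens a b = law p (fun t => (f t, g t)) (a, b).
Proof.
rewrite /dens; have [z|nz] := eqVneq (law p f a * law p g b) 0; last first.
  by rewrite mulrCA divff ?mulr1.
rewrite z mul0r; apply/esym/eqP; rewrite eq_le law_ge0 andbT.
by move/eqP: z; rewrite mulf_eq0 => /orP[] /eqP <-;
  [apply: law_pair_le_l|apply: law_pair_le_r].
Qed.

(** The terms are the conditional law of [f] given [b]; the sum drops to 0 when [b] has probability
    0. *)
Lemma sum_dens_le1 b : \sum_a law p f a * dens a b <= 1.
Proof.
have [z|nz] := eqVneq (law p g b) 0.
  by rewrite big1 // => a _; rewrite /dens z mulr0 invr0 !mulr0.
have gb : 0 < law p g b by rewrite lt_neqAle eq_sym nz law_ge0.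
rewrite -(ler_pM2l gb) mulr1 -law_marginal_r mulr_sumr; apply: ler_sum => a _.
by rewrite law_marginal_r mulrA [law p g b * _]mulrC dens_joint.
Qed.

(** The mean density of an independent codeword at a fixed block. It bounds both the competitors in
    the encoder and, through Markov's inequality, the wrong codewords at a decoder. *)
Lemma sum_prod_dens_le1 (N : nat) (y : 'I_N -> B) :
  \sum_(u : {ffun 'I_N -> A}) prod_law (law p f) u * \prod_n dens (u n) (y n) <= 1.
Proof.
rewrite /prod_law; under eq_bigr do rewrite -big_split.
rewrite (sum_prod_ffun (fun n u => law p f u * dens u (y n))).
apply: prodr_ile1 => n _; rewrite sum_dens_le1 andbT sumr_ge0 // => u _.
by rewrite mulr_ge0 ?law_ge0 ?dens_ge0.
Qed.

Lemma dens_gt0 t : p t != 0 -> 0 < dens (f t) (g t).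
Proof.
move=> pt; have {}pt : 0 < p t by rewrite lt_neqAle eq_sym pt p_ge0.
have H (C : finType) (h : T -> C) : 0 < law p h (h t).
  rewrite /law /Pr (bigD1 t) //=; apply: ltr_wpDr => //; exact: sumr_ge0.
by rewrite divr_gt0 ?mulr_gt0 // (H _ (fun t => (f t, g t))).
Qed.

Lemma mutual_infoE :
  mutual_info p f g = \sum_t p t * log2 (dens (f t) (g t)).
Proof.
rewrite (expect_law (fun t => (f t, g t)) (fun ab => log2 (dens ab.1 ab.2))).
by rewrite /mutual_info pair_bigA; apply: eq_bigr => -[a b] _.
Qed.

(* Gibbs' inequality, from [ln x >= 1 - 1 / x]. *)
Lemma mutual_info_ge0 : 0 <= mutual_info p f g.
Proof.
rewrite mutual_infoE.
have ln2 := @ln2_gt0 R.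
apply: le_trans (_ : \sum_t p t * ((1 - (dens (f t) (g t))^-1) / ln 2) <= _); last first.
  apply: ler_sum => t _; have [->|pt] := eqVneq (p t) 0; first by rewrite !mul0r.
  rewrite ler_wpM2l // /log2 ler_pM2r ?invr_gt0 //.
  have d0 := dens_gt0 pt; set x := dens _ _ in d0 *.
  have := @le_ln1Dx R (x^-1 - 1); rewrite addrCA subrr addr0 lnV ?posrE //.
  have -> : -1 < x^-1 - 1 by rewrite -subr_gt0 opprK subrK invr_gt0.
  by move=> /(_ isT); lra.
under eq_bigr do rewrite mulrA.
rewrite -mulr_suml divr_ge0 ?(ltW ln2) //.
under eq_bigr do rewrite mulrBr mulr1.
rewrite sumrB p_sum1 subr_ge0.
rewrite (expect_law (fun t => (f t, g t)) (fun ab => (dens ab.1 ab.2)^-1)).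
apply: le_trans (_ : \sum_(ab : A * B) law p f ab.1 * law p g ab.2 <= _).
  apply: ler_sum => -[a b] _ /=; rewrite -dens_joint.
  (* At density 0 the inverse is 0 as well, so the term vanishes and only an inequality holds. *)
  have [->|nz] := eqVneq (dens a b) 0; last by rewrite mulfK.
  by rewrite mulr0 mul0r mulr_ge0 ?law_ge0.
rewrite -(pair_bigA _ (fun a b => law p f a * law p g b)) /=.
under eq_bigr do rewrite -mulr_sumr sum_law mulr1.
by rewrite sum_law.
Qed.

Lemma prod_dens (N : nat) (c : {ffun 'I_N -> T}) : prod_law p c != 0 ->
  \prod_n dens (f (c n)) (g (c n)) =
  2 `^ (\sum_n log2 (dens (f (c n)) (g (c n)))).
Proof.
move=> pc; rewrite pow2_sum; apply: eq_bigr => n _; rewrite pow2_log2 // dens_gt0 //.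
by move/prodf_neq0: pc; apply.
Qed.

(** The weak law for the logarithm of the density, whose mean is the mutual information. The lower
    tail serves the decoding tests, the upper tail the covering of the state. *)
Lemma equipartition (delta : R) : 0 < delta -> exists2 C : R, 0 <= C &
  forall (N : nat) (E : pred {ffun 'I_N -> T}),
    (forall c, E c ->
       (\prod_n dens (f (c n)) (g (c n)) < 2 `^ (N%:R * (mutual_info p f g - delta))) ||
       (2 `^ (N%:R * (mutual_info p f g + delta)) < \prod_n dens (f (c n)) (g (c n)))) ->
    N%:R * \sum_(c | E c) prod_law p c <= C.
Proof.
move=> d0; have [C C0 HC] := weak_law p_ge0 p_sum1 (fun t => log2 (dens (f t) (g t))) d0.
exists C => // N E HE; apply: HC => c Ec pc.
rewrite -mutual_infoE; move: (HE c Ec); rewrite prod_dens //.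
rewrite !ltr_pow2.
set S := \sum_n _; set I := mutual_info _ _ _ => /orP[] h; rewrite ler_normr; apply/orP.
  by right; nra.
by left; nra.
Qed.

End Density.

(** * From single letters to blocks *)

(** The two outputs stay paired because the channel is a law on pairs. *)
Lemma sum_tuple5 (R : nmodType) (A B C D E : finType)
    (F : (A * B * C * D * E)%type -> R) :
  \sum_t F t =
  \sum_a \sum_b \sum_c \sum_(y : (D * E)%type) F (a, b, c, y.1, y.2).
Proof.
rewrite (pair_bigA _ (fun a b => \sum_c \sum_(y : (D * E)%type) F (a, b, c, y.1, y.2))).
rewrite (pair_bigA _ (fun ab c => \sum_(y : (D * E)%type) F (ab.1, ab.2, c, y.1, y.2))).
rewrite (pair_bigA _ (fun abc y => F (abc.1.1, abc.1.2, abc.2, y.1, y.2))) /=.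
rewrite (reindex (fun t : (A * B * C * (D * E))%type => (t.1, t.2.1, t.2.2))) /=.
  by apply: eq_bigr => -[[[a b] c] [y1 y2]] _.
by exists (fun t : (A * B * C * D * E)%type => (t.1.1, (t.1.2, t.2))) =>
  [[[[a b] c] [y1 y2]]|[[[[a b] c] y1] y2]].
Qed.

Section Blocks.
Context {R : realType} {W U X Y1 Y2 : finType}.
Variables (pW : W -> R) (pU : U -> R) (d : U -> W -> R).
Variables (pX : W -> U -> X -> R) (Q : X -> W -> (Y1 * Y2)%type -> R).
Variable N : nat.
Local Notation S := (@sample W X Y1 Y2 U).
Local Notation "T ^N" := {ffun 'I_N -> T} (at level 8, format "T ^N").

(** The one-letter law in the factored shape of the one-shot bound, with p(u) and a density in place
    of p(u | w). *)
Definition joint (t : S) : R :=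
  let '(w, u, x, y1, y2) := t in
  pW w * pU u * d u w * (pX w u x * Q x w (y1, y2)).

Definition dN (u : U^N) (w : W^N) : R := \prod_n d (u n) (w n).
Definition pXN (w : W^N) (u : U^N) (x : X^N) : R := \prod_n pX (w n) (u n) (x n).
Definition QN (x : X^N) (w : W^N) (y : Y1^N * Y2^N) : R :=
  \prod_n Q (x n) (w n) (y.1 n, y.2 n).

Lemma sum_QN x w : (forall x w, \sum_y Q x w y = 1) -> \sum_y QN x w y = 1.
Proof.
move=> Q1; rewrite /QN.
rewrite (reindex (fun c : (Y1 * Y2)%type^N => ([ffun n => (c n).1], [ffun n => (c n).2]))) /=.
  transitivity (\sum_(c : (Y1 * Y2)%type^N) \prod_n Q (x n) (w n) (c n)).
    apply: eq_bigr => c _; apply: eq_bigr => n _.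
    by rewrite !ffunE -surjective_pairing.
  by rewrite (sum_prod_ffun (fun n => Q (x n) (w n))) big1.
exists (fun y : Y1^N * Y2^N => [ffun n => (y.1 n, y.2 n)]) => [c|[y1 y2]] _ /=.
  by apply/ffunP => n; rewrite !ffunE -surjective_pairing.
by congr (_, _); apply/ffunP => n; rewrite !ffunE.
Qed.

Lemma sum_blocks (F : (W^N * U^N * X^N * Y1^N * Y2^N)%type -> R) :
  \sum_t F t = \sum_(c : S^N) F ([ffun n => rvW (c n)], [ffun n => rvU (c n)],
    [ffun n => (c n).1.1.2], [ffun n => rvY1 (c n)], [ffun n => rvY2 (c n)]).
Proof.
apply: reindex.
exists (fun t : (W^N * U^N * X^N * Y1^N * Y2^N)%type => [ffun n => (t.1.1.1.1 n, t.1.1.1.2 n, t.1.1.2 n, t.1.2 n, t.2 n)]).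
  by move=> c _; apply/ffunP => n; rewrite !ffunE /=; case: (c n) => [[[[? ?] ?] ?] ?].
by move=> [[[[w u] x] y1] y2] _ /=; congr (_, _, _, _, _); apply/ffunP => n; rewrite !ffunE.
Qed.

(** All factors are products over the coordinates, so an expectation of the one-shot bound becomes
    one under the i.i.d. law of the letters, where the weak law applies. *)
Lemma expect_blocks (A : W^N -> U^N -> Y1^N * Y2^N -> R) :
  \sum_w \sum_u prod_law pW w * prod_law pU u * dN u w * fwd pXN QN (A w u) w u =
  \sum_(c : S^N) prod_law joint c *
    A [ffun n => rvW (c n)] [ffun n => rvU (c n)]
      ([ffun n => rvY1 (c n)], [ffun n => rvY2 (c n)]).
Proof.
pose F (t : (W^N * U^N * X^N * Y1^N * Y2^N)%type) :=
  let '(w, u, x, y1, y2) := t in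
  prod_law pW w * prod_law pU u * dN u w *
  (pXN w u x * (QN x w (y1, y2) * A w u (y1, y2))).
transitivity (\sum_t F t).
  rewrite sum_tuple5; apply: eq_bigr => w _; apply: eq_bigr => u _.
  rewrite /fwd mulr_sumr; apply: eq_bigr => x _.
  by rewrite !mulr_sumr; apply: eq_bigr => -[y1 y2] _.
rewrite sum_blocks; apply: eq_bigr => c _; rewrite /F mulrA mulrA; congr (_ * _).
rewrite -mulrA /prod_law /dN /pXN /QN -!big_split; apply: eq_bigr => n _ /=.
by rewrite !ffunE; case: (c n) => [[[[w u] x] y1] y2].
Qed.

End Blocks.

(** * Message counts and rounding *)

Section Rates.
Context {R : realType}.

Lemma num_msg_gt0 (N : nat) (r : R) : (0 < num_msg N r)%N.
Proof.
by rewrite /num_msg absz_gt0 ceil_neq0 pow2_gt0 orbT.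
Qed.

Lemma num_msgE (N : nat) (r : R) :
  (num_msg N r)%:R = (Num.ceil (2 `^ (N%:R * r)))%:~R :> R.
Proof.
rewrite /num_msg natr_absz ger0_norm // ceil_ge0.
by apply: lt_trans (pow2_gt0 _); rewrite oppr_lt0.
Qed.

Lemma num_msg_ge (N : nat) (r : R) : 2 `^ (N%:R * r) <= (num_msg N r)%:R.
Proof. by rewrite num_msgE ceil_ge. Qed.

Lemma pred_num_msg_le (N : nat) (r : R) :
  (num_msg N r).-1%:R <= 2 `^ (N%:R * r).
Proof.
rewrite -subn1 natrB ?num_msg_gt0 // num_msgE.
by have /andP[/ltW] := ceil_itv (2 `^ (N%:R * r)); rewrite intrB.
Qed.

(** Rounding up adds less than 1, and 1 is at most the power itself for a nonnegative rate; hence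
    the factor 2. *)
Lemma num_msg_le (N : nat) (r : R) : 0 <= r ->
  (num_msg N r)%:R <= 2 * 2 `^ (N%:R * r).
Proof.
move=> r0; rewrite -(prednK (num_msg_gt0 N r)) -natr1 mulr2n mulrDl mul1r.
apply: lerD; first exact: pred_num_msg_le.
by have := ler_pow2 0 (N%:R * r); rewrite powRr0 => ->; rewrite mulr_ge0.
Qed.

Lemma num_msg0 (N : nat) : num_msg N (0 : R) = 1.
Proof. by rewrite /num_msg mulr0 powRr0 ceil1. Qed.

End Rates.

(** * Threshold tests at a receiver *)

Section Receiver.
Context {R : realType} {T U Y : finType}.
Variables (p : T -> R) (f : T -> U) (g : T -> Y).
Hypothesis p_ge0 : forall t, 0 <= p t.
Hypothesis p_sum1 : \sum_t p t = 1.

(* At rate 0 there is a single message, so the receiver may accept everything. *)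
Lemma receiver_test (r rho delta : R) : 0 < delta -> 0 <= rho ->
  r = 0 \/ r + rho + 2 * delta <= mutual_info p f g ->
  exists2 C : R, 0 <= C & forall N : nat,
  exists (V : {ffun 'I_N -> U} -> pred {ffun 'I_N -> Y}) (b : R),
  [/\ forall y, \sum_u prod_law (law p f) u * (V u y)%:R <= b,
      N%:R * (((num_msg N r).-1 * num_msg N rho)%:R * b) <= C &
      N%:R * (\sum_(c : {ffun 'I_N -> T}) prod_law p c *
        (~~ V [ffun n => f (c n)] [ffun n => g (c n)])%:R) <= C].
Proof.
move=> d0 rho0 [->|rI].
  exists 0 => // N; exists (fun _ _ => true), 1; split.
  - move=> y; under eq_bigr do rewrite mulr1.
    by rewrite sum_prod_law // sum_law.
  - by rewrite num_msg0 mul0n mul0r mulr0.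
  - by rewrite big1 ?mulr0 // => c _; rewrite mulr0.
have [C C0 HC] := equipartition p_ge0 p_sum1 f g d0.
exists (C + 2 * (delta * ln 2)^-1).
  by rewrite addr_ge0 // mulr_ge0 // invr_ge0 mulr_ge0 ?ltW ?ln2_gt0.
move=> N; set I := mutual_info p f g in rI HC *.
pose V (u : {ffun 'I_N -> U}) (y : {ffun 'I_N -> Y}) :=
  2 `^ (N%:R * (I - delta)) <= \prod_n dens p f g (u n) (y n).
(* By Markov's inequality the reciprocal of the threshold bounds the probability that an independent
   codeword passes. *)
exists V, (2 `^ (- (N%:R * (I - delta)))); split.
- move=> y; rewrite -(ler_pM2l (pow2_gt0 (N%:R * (I - delta)))) -pow2D subrr powRr0.
  apply: le_trans (sum_prod_dens_le1 p_ge0 f g y).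
  rewrite mulr_sumr; apply: ler_sum => u _; rewrite mulrCA.
  rewrite ler_wpM2l ?prod_law_ge0 // => [?|]; first exact: law_ge0.
  rewrite /V; case: (lerP (2 `^ _)) => [h|_]; first by rewrite mulr1.
  by rewrite mulr0 prodr_ge0 // => n _; apply: dens_ge0.
- rewrite -[leLHS]add0r; apply: lerD => //.
  apply: le_trans (_ : N%:R * (2 * 2 `^ (- (N%:R * delta))) <= _); last first.
    by rewrite mulrCA ler_wpM2l // nat_pow2_le.
  rewrite ler_wpM2l // natrM.
  apply: le_trans (_ : 2 `^ (N%:R * r) * (2 * 2 `^ (N%:R * rho)) *
     2 `^ (- (N%:R * (I - delta))) <= _).
    rewrite ler_wpM2r ?powR_ge0 // ler_pM // ?pred_num_msg_le ?num_msg_le //.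
  rewrite mulrCA -!mulrA ler_wpM2l // -!pow2D ler_pow2.
  (* The exponents add up to at most -N [delta], because [r + rho + 2 * delta <= I]. *)
  have : 0 <= N%:R :> R by []. nra.
rewrite -[leLHS]addr0; apply: lerD; last first.
  by rewrite mulr_ge0 // invr_ge0 mulr_ge0 ?ltW ?ln2_gt0.
pose E (c : {ffun 'I_N -> T}) := ~~ V [ffun n => f (c n)] [ffun n => g (c n)].
apply: le_trans (HC N E _).
  rewrite ler_wpM2l // [leRHS]big_mkcond; apply: ler_sum => c _ /=.
  by rewrite /E; case: (~~ _); rewrite ?mulr1 ?mulr0.
move=> c; rewrite /E /V -ltNge => h; apply/orP; left.
by under eq_bigr do rewrite -[f _](ffunE (fun n => f (c n))) -[g _](ffunE (fun n => g (c n))).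
Qed.

End Receiver.

(** * Block codes with error O(1/N) *)

Section Coding.
Context {R : realType} {W X Y1 Y2 U : finType}.
Variables (pW : fdist R W) (Q : X -> W -> fdist R (Y1 * Y2)%type).
Variable p : fdist R (@sample W X Y1 Y2 U).
Variables (pU : W -> fdist R U) (pX : W -> U -> fdist R X).
Hypothesis pE : forall w u x y1 y2,
  p (w, u, x, y1, y2) = pW w * pU w u * pX w u x * Q x w (y1, y2).
Local Notation S := (@sample W X Y1 Y2 U).
Let pU' := law p (@rvU W X Y1 Y2 U).
Let d := dens p (@rvU W X Y1 Y2 U) (@rvW W X Y1 Y2 U).

Lemma law_UW u w : law p (fun t : S => (rvU t, rvW t)) (u, w) = pW w * pU w u.
Proof.
rewrite /law /Pr big_mkcond sum_tuple5 /=.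
transitivity (\sum_w' \sum_u' if (u', w') == (u, w) then pW w' * pU w' u' else 0).
  apply: eq_bigr => w' _; apply: eq_bigr => u' _.
  case: ifP => _; last by rewrite big1 // => x _; rewrite big1.
  transitivity (pW w' * pU w' u' *
      \sum_x pX w' u' x * \sum_(y : Y1 * Y2) Q x w' y).
    rewrite mulr_sumr; apply: eq_bigr => x _; rewrite !mulr_sumr.
    by apply: eq_bigr => -[y1 y2] _; rewrite pE !mulrA.
  by under eq_bigr do rewrite Defs.pmf_sum1 mulr1; rewrite Defs.pmf_sum1 mulr1.
rewrite pair_bigA -big_mkcond (big_pred1 (w, u)) //= => -[w' u'] /=.
by rewrite !xpair_eqE andbC.
Qed.

Lemma law_W w : law p (@rvW W X Y1 Y2 U) w = pW w.
Proof.
rewrite -(law_marginal_r p (@rvU W X Y1 Y2 U)).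
by under eq_bigr do rewrite law_UW; rewrite -mulr_sumr Defs.pmf_sum1 mulr1.
Qed.

Lemma jointE : joint pW pU' d pX Q = p.
Proof.
apply: boolp.funext => -[[[[w u] x] y1] y2]; rewrite pE /joint -law_W /d.
rewrite [_ * pU' u]mulrC (dens_joint (Defs.pmf_ge0 p)) law_UW.
by rewrite law_W !mulrA.
Qed.

(** The maximum of the two error probabilities is at most their sum, the quantity controlled by
    [one_shot]. *)
Lemma Pe_le (N : nat) (r1 r2 : R) (c : @bc_code R W X Y1 Y2 N r1 r2) :
  Pe pW Q c <= \sum_m1 \sum_m2 (num_msg N r1)%:R^-1 * (num_msg N r2)%:R^-1 *
    \sum_w prod_law pW w * \sum_y QN Q (enc c m1 m2 w) w y *
      ((dec1 c y.1 m2 != m1)%:R + (dec2 c y.2 m1 != m2)%:R).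
Proof.
apply: (@le_trans _ _ (Pe1 pW Q c + Pe2 pW Q c)).
  have cl0 t : 0 <= code_law pW Q c t.
    move: t => [[[[m1 m2] w] y1] y2]; rewrite /code_law !mulr_ge0 ?invr_ge0 //;
    by apply: prodr_ge0 => n _; apply: Defs.pmf_ge0.
  by rewrite ge_max lerDl lerDr !sumr_ge0.
rewrite /Pe1 /Pe2 /Pr big_mkcond [X in _ + X]big_mkcond -big_split /= sum_tuple5.
apply: ler_sum => m1 _; apply: ler_sum => m2 _.
rewrite mulr_sumr; apply: ler_sum => w _; rewrite !mulr_sumr; apply: ler_sum => y _.
rewrite /QN /=; case: (_ != m1); case: (_ != m2); rewrite /= ?mulrDr ?mulr1 ?mulr0 ?addr0 ?add0r ?mulrA //.
Qed.

(** Strict rate inequalities leave room for an index rate above I(U; W) and for the margins of the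
    tests. A zero rate is a separate alternative, since the strict inequality may fail there. *)
Lemma good_codes (r1 r2 : R) :
  let Iw := mutual_info p (@rvU W X Y1 Y2 U) (@rvW W X Y1 Y2 U) in
  r1 = 0 \/ r1 < mutual_info p (@rvU W X Y1 Y2 U) (@rvY1 W X Y1 Y2 U) - Iw ->
  r2 = 0 \/ r2 < mutual_info p (@rvU W X Y1 Y2 U) (@rvY2 W X Y1 Y2 U) - Iw ->
  exists C : R, forall N : nat,
    exists c : @bc_code R W X Y1 Y2 N r1 r2, N%:R * Pe pW Q c <= C.
Proof.
move=> Iw r1I r2I.
have p0 := Defs.pmf_ge0 p; have p1 := Defs.pmf_sum1 p.
have Iw0 : 0 <= Iw by apply: mutual_info_ge0.
have slack (r J : R) : r = 0 \/ r < J - Iw -> exists2 delta, 0 < delta &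
    forall e, 0 < e <= delta -> r = 0 \/ r + (Iw + 2 * e) + 2 * e <= J.
  (* The gap pays for four margins: two that raise the index rate above [Iw] and two for the
     receiver; hence the division by 4. *)
  case=> [r0|rJ]; first by exists 1 => //; left.
  exists ((J - Iw - r) / 4); first by rewrite divr_gt0 ?subr_gt0.
  by move=> e /andP[e0]; rewrite ler_pdivlMr // => ?; right; lra.
have [d1 d10 H1] := slack _ _ r1I; have [d2 d20 H2] := slack _ _ r2I.
pose delta := Num.min d1 d2.
have de0 : 0 < delta by rewrite lt_min d10.
have {}H1 := H1 delta; rewrite de0 ge_min lexx /= in H1.
have {}H2 := H2 delta; rewrite de0 ge_min lexx orbT /= in H2.
pose rho := Iw + 2 * delta.
have rho0 : 0 <= rho by rewrite addr_ge0 // mulr_ge0 // ltW.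
have [C1 C10 HC1] := receiver_test p0 p1 de0 rho0 (H1 isT).
have [C2 C20 HC2] := receiver_test p0 p1 de0 rho0 (H2 isT).
have [C3 C30 HC3] := equipartition p0 p1 (@rvU W X Y1 Y2 U) (@rvW W X Y1 Y2 U) de0.
(* Each receiver pays once for missing the right codeword and once for accepting a wrong one; the
   last term is the covering failure, doubled as in [one_shot]. *)
exists (2 * C1 + 2 * C2 + 2 * ((delta * ln 2)^-1 + C3)) => N.
have [V1 [b1 [Hb1 HK1 HA1]]] := HC1 N; have [V2 [b2 [Hb2 HK2 HA2]]] := HC2 N.
(* The threshold lies one margin above [Iw] and one below the index rate [rho]: exceeding it is
   atypical, and its ratio to the number of codewords is exponentially small. *)
pose tau : R := 2 `^ (N%:R * (Iw + delta)).
have tau0 : 0 < tau by apply: pow2_gt0.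
pose k1 : msg N r1 := Ordinal (num_msg_gt0 N r1).
pose k2 : msg N r2 := Ordinal (num_msg_gt0 N r2).
pose L : finType := msg N rho.
have L0 : (0 < #|L|)%N by rewrite card_ord num_msg_gt0.
have pU0 u : 0 <= pU' u by apply: law_ge0.
have pU1 : \sum_u pU' u = 1 by apply: sum_law.
have Q0 (x : {ffun 'I_N -> X}) w y : 0 <= QN Q x w y :> R by apply: prodr_ge0 => n _; apply: Defs.pmf_ge0.
have Q1 (x : {ffun 'I_N -> X}) w : \sum_y QN Q x w y = 1 :> R by apply: sum_QN => ? ?; apply: Defs.pmf_sum1.
have X0 (w : {ffun 'I_N -> W}) u x : 0 <= pXN pX w u x :> R.
  by apply: prodr_ge0 => n _; apply: Defs.pmf_ge0.
have X1 (w : {ffun 'I_N -> W}) u : \sum_x pXN pX w u x = 1 :> R.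
  rewrite /pXN (sum_prod_ffun (fun n => pX (w n) (u n))) big1 // => n _.
  exact: Defs.pmf_sum1.
have d0 (u : {ffun 'I_N -> U}) w : 0 <= dN d u w.
  by apply: prodr_ge0 => n _; apply: dens_ge0.
have dle (w : {ffun 'I_N -> W}) : \sum_u prod_law pU' u * dN d u w <= 1.
  exact: sum_prod_dens_le1.
have EB := expect_blocks pW pU' d pX Q; rewrite jointE in EB.
have dsum : \sum_(w : {ffun 'I_N -> W}) \sum_u
    prod_law pW w * prod_law pU' u * dN d u w = 1.
  rewrite -(@sum_prod_law R 'I_N _ p p1).
  have := EB N (fun _ _ _ => 1); under eq_bigr do under eq_bigr do
    rewrite (fwd_cst X1 Q1) mulr1.
  by move=> ->; apply: eq_bigr => c _; rewrite mulr1.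
have [enc [dec1 [dec2 Hcode]]] := one_shot
  (prod_law_ge0 (Defs.pmf_ge0 pW)) (sum_prod_law (Defs.pmf_sum1 pW))
  (prod_law_ge0 pU0) (sum_prod_law pU1) d0 dle dsum X0 X1 Q0 Q1 L0 Hb1 Hb2 k1 k2 tau0.
exists (BCCode enc dec1 dec2).
apply: le_trans (ler_wpM2l (ler0n _ _) (Pe_le _)) _.
rewrite !card_ord in Hcode.
apply: le_trans (ler_wpM2l (ler0n _ _) Hcode) _.
rewrite (EB N (fun _ u => atypical V1 V2 u)).
(* An indicator that ignores the output is left unchanged by [fwd], so [expect_blocks] turns this
   mass into an i.i.d. probability. *)
have -> : \sum_(w : {ffun 'I_N -> W}) \sum_(u | tau < dN d u w)
    prod_law pW w * prod_law pU' u * dN d u w =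
  \sum_(c : {ffun 'I_N -> S} | tau < \prod_n d (rvU (c n)) (rvW (c n))) prod_law p c.
  transitivity (\sum_(w : {ffun 'I_N -> W}) \sum_u prod_law pW w * prod_law pU' u *
      dN d u w * fwd (@pXN _ _ _ _ pX N) (@QN _ _ _ _ _ Q N) (fun=> (tau < dN d u w)%R%:R) w u).
    apply: eq_bigr => w _; rewrite big_mkcond; apply: eq_bigr => u _.
    by rewrite (fwd_cst X1 Q1); case: ifP; rewrite ?mulr1 ?mulr0.
  rewrite (EB N (fun w u _ => (tau < dN d u w)%R%:R)) [RHS]big_mkcond.
  apply: eq_bigr => c _; rewrite /dN.
  under eq_bigr do rewrite !ffunE.
  by case: ifP; rewrite ?mulr1 ?mulr0.
have H3 : N%:R * \sum_(c : {ffun 'I_N -> S} |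
    tau < \prod_n d (rvU (c n)) (rvW (c n))) prod_law p c <= C3.
  by apply: HC3 => c ->; rewrite orbT.
have H4 : N%:R * (tau / #|L|%:R) <= (delta * ln 2)^-1.
  apply: le_trans (nat_pow2_le N de0); rewrite ler_wpM2l //.
  rewrite card_ord ler_pdivrMr ?ltr0n ?num_msg_gt0 //.
  apply: le_trans (ler_wpM2l (powR_ge0 _ _) (num_msg_ge N rho)).
  by rewrite -pow2D /tau ler_pow2 /rho; lra.
rewrite /atypical /=; under eq_bigr do rewrite mulrDr.
rewrite big_split /=; move: HA1 HA2 HK1 HK2 H3 H4; rewrite card_ord.
lra.
Qed.

Lemma good_rates_achievable (r1 r2 : R) :
  let Iw := mutual_info p (@rvU W X Y1 Y2 U) (@rvW W X Y1 Y2 U) in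
  0 <= r1 -> 0 <= r2 ->
  r1 = 0 \/ r1 < mutual_info p (@rvU W X Y1 Y2 U) (@rvY1 W X Y1 Y2 U) - Iw ->
  r2 = 0 \/ r2 < mutual_info p (@rvU W X Y1 Y2 U) (@rvY2 W X Y1 Y2 U) - Iw ->
  achievable pW Q (r1, r2).
Proof.
move=> Iw r10 r20 h1 h2; split=> //; split=> //=.
have [C HC] := good_codes h1 h2.
pose c N := sval (boolp.cid (HC N)).
have cP N : N%:R * Pe pW Q (c N) <= C by exact: (svalP (boolp.cid (HC N))).
exists c; apply/cvgrPdist_lt => e e0.
have Pe0 N : 0 <= Pe pW Q (c N).
  rewrite le_max; apply/orP; left; apply: sumr_ge0 => -[[[[m1 m2] w] y1] y2] _.
  rewrite /code_law !mulr_ge0 ?invr_ge0 //;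
  by apply: prodr_ge0 => n _; apply: Defs.pmf_ge0.
near=> N.
rewrite sub0r normrN ger0_norm //.
have N0 : 0 < N%:R :> R by rewrite ltr0n; near: N; exists 1%N.
rewrite -(ltr_pM2l N0); apply: le_lt_trans (cP N) _.
rewrite -ltr_pdivrMr //; near: N; exact: nbhs_infty_gtr.
Unshelve. all: by end_near. Qed.

End Coding.

(** * Convex hull, closure and the inclusion of regions *)

(** A convex [A] is one of the sets whose intersection is the hull, so the hull lies inside [A]. *)
Lemma convex_hull_min (R : realType) (A C : set (R^o * R^o)) :
  (forall x y t, A x -> A y -> 0 <= t <= 1 ->
     A (t * x.1 + (1 - t) * y.1, t * x.2 + (1 - t) * y.2)) ->
  (A `<=` C)%classic -> (convex_hull A `<=` C)%classic.
Proof.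
move=> Aconv sub_AC r /(_ A) Ar; apply: sub_AC; apply: Ar; split => // x y t.
rewrite !inE => Ax Ay.
by apply: (Aconv x y t%:num Ax Ay); rewrite ge0 le1.
Qed.

Local Open Scope classical_set_scope.

Theorem theorem3p4 (R : realType) (W X Y1 Y2 : finType)
  (pW : fdist R W) (Q : X -> W -> fdist R (Y1 * Y2)%type) :
  R2in pW Q `<=` capacity_region pW Q.
Proof.
move=> r [U [p [[pU [pX pE]]]]]; rewrite /R2in_of.
set I1 := mutual_info p _ (@rvY1 _ _ _ _ _).
set I2 := mutual_info p _ (@rvY2 _ _ _ _ _).
set Iw := mutual_info p _ (@rvW _ _ _ _ _).
move: r; apply: convex_hull_min.
  move=> x y t [x1 x2 x3 x4] [y1 y2 y3 y4] /andP[t0 t1].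
  have s0 : 0 <= 1 - t by rewrite subr_ge0.
  by split=> /=; nra.
move=> r [r1 r2 rI1 rI2] B /nbhs_ballP[e /= e0 Be].
(* Lowering by half the radius, cut off at 0, stays inside the ball and yields either the rate 0 or
   a strict inequality, the two alternatives of [good_rates_achievable]. *)
pose lower (s : R) := Num.max 0 (s - e / 2).
have lower_ball s : 0 <= s -> `|s - lower s| < e.
  move=> s0; rewrite /lower; case: (leP 0 (s - e / 2)) => h.
    by rewrite opprB addrC subrK ger0_norm; lra.
  by rewrite subr0 ger0_norm //; lra.
have lower_rate s J : s <= J -> lower s = 0 \/ lower s < J.
  move=> sJ; rewrite /lower; case: (leP 0 (s - e / 2)) => h; last by left.
  by right; lra.
exists (lower r.1, lower r.2); split.
  apply: (good_rates_achievable pE); rewrite ?le_max ?lexx //;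
  exact: lower_rate.
by apply: Be; split; rewrite /ball /=; apply: lower_ball.
Qed.
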